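(* Let $p$ be a prime. If $G$ is a $p$-group of nilpotency class $2$ with character degree set $\mathrm{cd}(G) = \{1, p\}$, then $\rho_0(G) = 1$.
   Context: A $p$-group means a finite group of order $p^n$ for a prime $p$ and a positive integer $n$. $\mathrm{cd}(G) = \{\chi(1) \mid \chi \in \mathrm{Irr}(G)\}$ is the set of degrees of the complex irreducible characters of $G$. $Z(G)$ is the centre of $G$ and $G'$ its commutator subgroup; $G$ has nilpotency class $2$ if it is nonabelian and $\{1\} < G' \leq Z(G) < G$. A triple $(S,T,U)$ of subgroups of a group $G$ is a subgroup TPP triple of $G$ if for all $s\in S$, $t\in T$, $u\in U$ one has $stu=1 \iff s=t=u=1$. For a finite group $G$ the subgroup TPP ratio is $\rho_0(G) := \max \frac{|S||T||U|}{|G|}$, where the maximum is over all subgroup TPP triples $(S,T,U)$ of $G$. *)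

(* Defs.v *)
From mathcomp Require Import all_boot all_order all_algebra.
From mathcomp Require Import all_fingroup all_solvable all_field all_character.

Set Implicit Arguments.
Unset Strict Implicit.
Unset Printing Implicit Defensive.

Import Order.TTheory GRing.Theory Num.Theory.

Local Open Scope ring_scope.

(* As a set: repetitions in the sequence are irrelevant, and it is only meant
   to be compared with =i. *)
Definition cd (gT : finGroupType) (G : {group gT}) : seq algC :=
  [seq 'chi[G]_i 1%g | i : Iirr G].

Definition subgroup_TPP (gT : finGroupType) (G S T U : {group gT}) : bool :=
  [&& S \subset G, T \subset G, U \subset G &
   [forall s in S, forall t in T, forall u in U,
      (s * t * u == 1)%g == [&& s == 1%g, t == 1%g & u == 1%g]]].

(* The default value 0 never matters: the trivial triple is a TPP triple and
   all the ratios are positive; see rho0_ge and rho0_attained. *)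
Definition rho0 (gT : finGroupType) (G : {group gT}) : rat :=
  \big[Num.max/0]_(X : {group gT} * {group gT} * {group gT}
                   | subgroup_TPP G X.1.1 X.1.2 X.2)
    ((#|X.1.1| * #|X.1.2| * #|X.2|)%N%:R / #|G|%:R).

Lemma rho0_ge (gT : finGroupType) (G S T U : {group gT}) :
  subgroup_TPP G S T U -> (#|S| * #|T| * #|U|)%N%:R / #|G|%:R <= rho0 G.
Proof.
move=> tpp; rewrite /rho0.
exact: (le_bigmax_cond _
  (fun X : {group gT} * {group gT} * {group gT} =>
     (#|X.1.1| * #|X.1.2| * #|X.2|)%N%:R / #|G|%:R : rat) (j := (S, T, U))).
Qed.

Lemma subgroup_TPP1 (gT : finGroupType) (G : {group gT}) :
  subgroup_TPP G 1%G 1%G 1%G.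
Proof.
rewrite /subgroup_TPP !sub1G /=.
apply/forall_inP=> s /set1P->; apply/forall_inP=> t /set1P->.
by apply/forall_inP=> u /set1P->; rewrite !mulg1 !eqxx.
Qed.

Lemma rho0_attained (gT : finGroupType) (G : {group gT}) :
  exists S T U : {group gT}, subgroup_TPP G S T U /\
    rho0 G = (#|S| * #|T| * #|U|)%N%:R / #|G|%:R.
Proof.
have ge0 (X : {group gT} * {group gT} * {group gT}) :
    subgroup_TPP G X.1.1 X.1.2 X.2 ->
    0 <= (#|X.1.1| * #|X.1.2| * #|X.2|)%N%:R / #|G|%:R :> rat.
  by move=> _; rewrite divr_ge0 ?ler0n.
rewrite /rho0 (bigmax_eq_arg _ (1%G, 1%G, 1%G)) //=; last exact: subgroup_TPP1.
case: arg_maxP => [|[[S T] U] /= tpp _]; first exact: subgroup_TPP1.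
by exists S, T, U.
Qed.

Lemma nil_class2E (gT : finGroupType) (G : {group gT}) : nilpotent G ->
  (nil_class G == 2%N) =
    [&& ~~ abelian G, 1%G \proper (G^`(1))%g, (G^`(1) \subset 'Z(G))%g
      & ('Z(G) \proper G)%g].
Proof.
move=> nilG; rewrite eqn_leq andbC ltnNge nil_class1.
have [//|nabG] := boolP (abelian G); rewrite /= proper1G.
have -> : ('Z(G) \proper G)%g.
  rewrite properEneq center_sub andbT; apply: contra nabG => /eqP.
  by move/center_idP.
have -> : (G^`(1) != 1)%g.
  by apply: contra nabG => /eqP derG1; apply/commG1P; rewrite -derg1.
rewrite /= andbT subsetI der_sub /=.
by rewrite (sameP (lcn_nil_classP 2 nilG) eqP) (sameP commG1P eqP).
Qed.

(* Main.v *)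
Require Import Defs.
From mathcomp Require Import all_boot all_order all_algebra.
From mathcomp Require Import all_fingroup all_solvable all_field all_character.
From mathcomp Require Import ring.

(** The triple (G, 1, 1) shows that the ratio is at least 1, so the point is the
inequality |S||T||U| <= |G| for every subgroup TPP triple of G.

Two observations carry the combinatorial half. If T normalises U then TU is a
subgroup meeting S trivially, and the inequality follows
([TPP_bound_norm]). If N is a normal subgroup of G contained in S, then the
images of S, T, U form a TPP triple of G / N, and the inequality there implies
the one in G ([TPP_bound_quotient]). Since the TPP is invariant under rotating
the triple, both apply to any of the three factors. They allow an induction on
|G| in two situations.

- G is a p-group with an abelian normal subgroup A of index p
  ([TPP_bound_abelian]). If S is not contained in A then G = AS, so the
  intersection of S and A is normal in G and may be factored out. In the end
  each factor lies in A or has order at most p, and a short count concludes.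
- G is a p-group with a central subgroup C of index p ^ 3
  ([TPP_bound_central]). The intersection of S and C may be factored out; then
  |S| divides p ^ 3. If |S| = p ^ 3 then G = SC and S is normal; if
  |S| = p ^ 2 then SC is abelian of index p and the former case applies; and if
  all three orders are at most p then their product is at most
  p ^ 3 = |G : C|.

It remains to see that a p-group of class 2 with degrees 1 and p is of one of
these kinds ([degrees_1p_structure]). For chi nonlinear irreducible let Z(chi)
be its centre. In class 2, chi(1) ^ 2 = |G : Z(chi)|, so Z(chi) has index
p ^ 2. If Z(chi) Z(psi) = G for two such characters, then the centre of any
constituent of chi psi lies in the intersection of Z(chi) and Z(psi), which
has index p ^ 4: the constituent would have degree at least p ^ 2, which is
excluded.
Thus the Z(chi) behave like subspaces of codimension 2 no two of which span
the whole space; dually, like lines of a projective space that meet pairwise,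
which are concurrent or coplanar. Accordingly there are two possibilities
([codim2_join_alternative]). Either they all lie in a subgroup H of index p,
and then H is abelian since each chi sees it as a cyclic extension of a
central subgroup; or they all contain a subgroup of index p ^ 3, which is then
central. *)

Set Implicit Arguments.
Unset Strict Implicit.
Unset Printing Implicit Defensive.

Import Order.TTheory GRing.Theory Num.Theory.

Local Open Scope ring_scope.

(** * Subgroup triples with the triple product property *)

Section TripleProduct.

Local Open Scope group_scope.

Lemma subgroup_TPPP (gT : finGroupType) (G S T U : {group gT}) :
  reflect [/\ S \subset G, T \subset G, U \subset G &
            forall s t u, s \in S -> t \in T -> u \in U ->
              s * t * u = 1 -> [/\ s = 1, t = 1 & u = 1]]
          (subgroup_TPP G S T U).
Proof.
apply: (iffP and4P) => [] [sSG sTG sUG tpp]; split=> //.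
  move=> s t u Ss Tt Uu /eqP; move/forall_inP/(_ s Ss): tpp.
  move/forall_inP/(_ t Tt)/forall_inP/(_ u Uu)/eqP->.
  by case/andP=> /eqP-> /andP[/eqP-> /eqP->].
apply/forall_inP=> s Ss; apply/forall_inP=> t Tt; apply/forall_inP=> u Uu.
apply/eqP; apply/idP/idP=> [/eqP stu1 | /and3P[/eqP-> /eqP-> /eqP->]].
  by have [-> -> ->] := tpp s t u Ss Tt Uu stu1; rewrite eqxx.
by rewrite !mulg1.
Qed.

Lemma subgroup_TPP_rot (gT : finGroupType) (G S T U : {group gT}) :
  subgroup_TPP G S T U -> subgroup_TPP G T U S.
Proof.
case/subgroup_TPPP=> sSG sTG sUG tpp; apply/subgroup_TPPP; split=> //.
move=> t u s Tt Uu Ss tus1.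
have stu1: s * t * u = 1.
  by apply: (mulIg s); rewrite mul1g -!mulgA (mulgA t) tus1 mulg1.
by have [-> -> ->] := tpp s t u Ss Tt Uu stu1.
Qed.

Lemma subgroup_TPP_TI (gT : finGroupType) (G S T U : {group gT}) :
  subgroup_TPP G S T U -> S :&: T = 1.
Proof.
case/subgroup_TPPP=> _ _ _ tpp; apply/trivgP/subsetP=> x /setIP[Sx Tx].
have Tx': x^-1 \in T by rewrite groupV.
have [|-> _ _] := tpp x x^-1 1 Sx Tx' (group1 U); last exact: set11.
by rewrite mulg1 mulgV.
Qed.

(** The product TU is a subgroup, and by the TPP the intersections of T with U
and of S with TU are trivial, so that S(TU) has |S||T||U| elements. *)
Lemma TPP_bound_norm (gT : finGroupType) (G S T U : {group gT}) :
  subgroup_TPP G S T U -> T \subset 'N(U) -> (#|S| * #|T| * #|U| <= #|G|)%N.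
Proof.
move=> tppG nUT; have [sSG sTG sUG tpp] := subgroup_TPPP _ _ _ _ tppG.
have tiTU := subgroup_TPP_TI (subgroup_TPP_rot tppG).
have tiSTU: S :&: T <*> U = 1.
  apply/trivgP/subsetP=> x /setIP[Sx]; rewrite /= norm_joinEl //.
  case/mulsgP=> t u Tt Uu def_x.
  have Sx': x^-1 \in S by rewrite groupV.
  have [|/eqP] := tpp x^-1 t u Sx' Tt Uu.
    by rewrite -mulgA -def_x mulVg.
  by rewrite invg_eq1 inE => ->.
rewrite -mulnA -(TI_cardMg tiTU) -norm_joinEl // -(TI_cardMg tiSTU).
by rewrite subset_leq_card // mul_subG // join_subG sTG.
Qed.

(** A relation stu = 1 modulo N reads stu = n in G with n in N; since N lies in
S, the element n can be absorbed into s, so the TPP of G forces t = u = 1 and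
s in N. As T and U meet N trivially, only the orders of S and G drop, both by
the factor |N|. *)
Lemma TPP_bound_quotient (gT : finGroupType) (G S T U N : {group gT}) :
    N <| G -> N \subset S -> subgroup_TPP G S T U ->
    (subgroup_TPP (G / N) (S / N) (T / N) (U / N) ->
       (#|S / N| * #|T / N| * #|U / N| <= #|G / N|)%N) ->
  (#|S| * #|T| * #|U| <= #|G|)%N.
Proof.
move=> nsNG sNS tppG; have [sSG sTG sUG tpp] := subgroup_TPPP _ _ _ _ tppG.
have [sNG nNG] := andP nsNG.
have [nNS nNT nNU]: [/\ S \subset 'N(N), T \subset 'N(N) & U \subset 'N(N)].
  by split; apply: subset_trans nNG.
have tiTN: N :&: T = 1.
  by apply/trivgP; rewrite -(subgroup_TPP_TI tppG) setSI.
have tiUN: N :&: U = 1.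
  apply/trivgP.
  rewrite -(subgroup_TPP_TI (subgroup_TPP_rot (subgroup_TPP_rot tppG))).
  by rewrite subsetI subsetIr (subset_trans _ sNS) ?subsetIl.
move=> le_quo; have {}le_quo: (#|S / N| * #|T / N| * #|U / N| <= #|G / N|)%N.
  apply: le_quo.
  apply/subgroup_TPPP; split; rewrite ?quotientS //.
  move=> sN tN uN /morphimP[s nNs Ss ->] /morphimP[t nNt Tt ->].
  case/morphimP=> u nNu Uu -> stu1.
  have Nstu: s * t * u \in N.
    by apply: coset_idr; rewrite ?groupM // !morphM ?groupM.
  have Sns: (s * t * u)^-1 * s \in S by rewrite groupM // groupV (subsetP sNS).
  have [|_ t1 u1] := tpp _ t u Sns Tt Uu; first by rewrite -!mulgA mulVg.
  move: Nstu; rewrite t1 u1 !mulg1 => Ns.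
  by split; rewrite ?morph1 //; apply: coset_id.
rewrite -(Lagrange sNS) -(Lagrange sNG) -!card_quotient //.
rewrite (card_isog (quotient_isog nNT tiTN)).
rewrite (card_isog (quotient_isog nNU tiUN)).
by rewrite -!mulnA leq_mul2l mulnA le_quo orbT.
Qed.

(** Rotating the triple turns a dichotomy for its first member into one for all
three members. *)
Lemma TPP_bound_or_all (gT : finGroupType) (G : {group gT})
    (small : pred {group gT}) :
    (forall X Y Z, subgroup_TPP G X Y Z ->
       small X \/ (#|X| * #|Y| * #|Z| <= #|G|)%N) ->
  forall S T U, subgroup_TPP G S T U ->
    [/\ small S, small T & small U] \/ (#|S| * #|T| * #|U| <= #|G|)%N.
Proof.
move=> small_or S T U tppG; have tppG1 := subgroup_TPP_rot tppG.
have [smallS | leS] := small_or _ _ _ tppG; last by right.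
have [smallT | leT] := small_or _ _ _ tppG1; last first.
  by right; rewrite -mulnA mulnC.
have [smallU | leU] := small_or _ _ _ (subgroup_TPP_rot tppG1); first by left.
by right; rewrite mulnC mulnA.
Qed.

(** Once the normal subgroups X :&: A have been factored out, every member X of
the triple lies in A or satisfies |X| <= p. What is left is a case distinction
on the number of members inside A: two of them commute; if there is only one,
it is either A itself, which is normal, or of order at most |A| / p; if there
is none, the product is at most p ^ 3, which exceeds |G| only if |G| divides
p ^ 2, and then G is abelian. *)
Theorem TPP_bound_abelian (p : nat) (gT : finGroupType)
    (G A S T U : {group gT}) :
    prime p -> p.-group G -> A <| G -> abelian A -> #|G : A| = p ->
    subgroup_TPP G S T U ->
  (#|S| * #|T| * #|U| <= #|G|)%N.
Proof.
move=> p_pr; have [n] := ubnP #|G|.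
elim: n => // n IHn in gT G A S T U *; rewrite ltnS => leGn.
move=> pG nsAG abA iAG tppG; have [sAG nAG] := andP nsAG.
have maxA: maximal A G by rewrite p_index_maximal // iAG.
have cardG: #|G| = (p * #|A|)%N by rewrite -(Lagrange sAG) iAG mulnC.
pose small (X : {group gT}) := (X \subset A) || (#|X| <= p)%N.
have small_or (X Y Z : {group gT}) : subgroup_TPP G X Y Z ->
    small X \/ (#|X| * #|Y| * #|Z| <= #|G|)%N.
  move=> tppX; rewrite /small.
  have [|nsXA] := boolP (X \subset A); first by left.
  have [sXG _ _ _] := subgroup_TPPP _ _ _ _ tppX.
  have defG: A * X = G by apply: mulg_normal_maximal.
  have nsXAG: X :&: A <| G.
    rewrite /normal subIset ?sXG //= -defG mulG_subG.
    rewrite (normsI (normG X) (subset_trans sXG nAG)) andbT.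
    by rewrite (subset_trans abA) // cents_norm // centS // subsetIr.
  have [tiXA | ntXA] := eqVneq (X :&: A) 1.
    left; apply/orP; right; rewrite -(leq_pmul2r (cardG_gt0 A)) -cardG.
    by rewrite -(TI_cardMg tiXA) subset_leq_card // mul_subG.
  right; apply: (TPP_bound_quotient nsXAG _ tppX); first exact: subsetIl.
  apply: (IHn _ _ (A / (X :&: A))%G).
  - by apply: leq_trans leGn; rewrite ltn_quotient ?normal_sub.
  - exact: quotient_pgroup.
  - exact: quotient_normal.
  - exact: quotient_abelian.
  by rewrite index_quotient_eq ?normal_norm // subIset // subsetIr orbT.
have tppG1 := subgroup_TPP_rot tppG; have tppG2 := subgroup_TPP_rot tppG1.
have twoA (X Y Z : {group gT}) : subgroup_TPP G X Y Z ->
    Y \subset A -> Z \subset A -> (#|X| * #|Y| * #|Z| <= #|G|)%N.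
  move=> tppX sYA sZA; apply: TPP_bound_norm (tppX) _.
  by rewrite cents_norm // (centsS sZA) // (subset_trans sYA).
have oneA (X Y Z : {group gT}) : subgroup_TPP G X Y Z -> (#|X| <= p)%N ->
    (#|Y| <= p)%N -> Z \subset A -> (#|X| * #|Y| * #|Z| <= #|G|)%N.
  move=> tppX leX leY sZA; have [eqZA | neqZA] := eqVneq Z A.
    rewrite {}eqZA in tppX *.
    have [_ sYG _ _] := subgroup_TPPP _ _ _ _ tppX.
    by apply: TPP_bound_norm tppX _; apply: subset_trans nAG.
  have leZ: (p * #|Z| <= #|A|)%N.
    have gt1: (1 < #|A : Z|)%N.
      rewrite indexg_gt1; apply: contra neqZA => sAZ.
      by rewrite -val_eqE eqEsubset sZA.
    have /p_natP[k def_k] : p.-nat #|A : Z|.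
      by apply: pnat_dvd (dvdn_indexg A Z) (pgroupS sAG pG).
    rewrite -(Lagrange sZA) mulnC leq_mul2l def_k.
    case: k def_k gt1 => [-> // | k _ _].
    by rewrite expnS leq_pmulr ?orbT // expn_gt0 prime_gt0.
  by rewrite cardG -mulnA leq_mul // (leq_trans _ leZ) // leq_mul2r leY orbT.
have rot1: (#|S| * #|T| * #|U| = #|T| * #|U| * #|S|)%N by rewrite -mulnA mulnC.
have rot2: (#|S| * #|T| * #|U| = #|U| * #|S| * #|T|)%N by rewrite mulnC mulnA.
have [[smallS smallT smallU] | //] := TPP_bound_or_all small_or tppG.
case/orP: smallS => hS; case/orP: smallT => hT; case/orP: smallU => hU.
- exact: twoA.
- by rewrite rot2 twoA.
- by rewrite rot1 twoA.
- by rewrite rot1 oneA.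
- exact: twoA.
- by rewrite rot2 oneA.
- exact: oneA.
have [le_logG | gt_logG] := leqP (logn p #|G|) 2.
  have abG: abelian G := p2group_abelian pG le_logG.
  have [_ sTG sUG _] := subgroup_TPPP _ _ _ _ tppG.
  apply: TPP_bound_norm tppG _.
  by rewrite cents_norm // (centsS sUG) // (subset_trans sTG).
rewrite (card_pgroup pG) (@leq_trans (p ^ 3)) //; last first.
  by rewrite leq_exp2l ?prime_gt1.
by rewrite !expnS expn0 muln1 mulnA !leq_mul.
Qed.

(** Once X :&: C = 1 for each member X of the triple, XC has order |X||C|, so
that |X| divides p ^ 3; the orders p ^ 2 and p ^ 3 are settled by the abelian
subgroup XC of index p and by the normality of X respectively. *)
Theorem TPP_bound_central (p : nat) (gT : finGroupType)
    (G C S T U : {group gT}) :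
    prime p -> p.-group G -> C \subset 'Z(G) -> #|G : C| = (p ^ 3)%N ->
    subgroup_TPP G S T U ->
  (#|S| * #|T| * #|U| <= #|G|)%N.
Proof.
move=> p_pr; have [n] := ubnP #|G|.
elim: n => // n IHn in gT G C S T U *; rewrite ltnS => leGn.
move=> pG sCZ iCG tppG.
have sCG: C \subset G := subset_trans sCZ (center_sub G).
have cGC: G \subset 'C(C) by rewrite centsC (subset_trans sCZ) ?subsetIr.
have small_or (X Y Z : {group gT}) : subgroup_TPP G X Y Z ->
    (#|X| <= p)%N \/ (#|X| * #|Y| * #|Z| <= #|G|)%N.
  move=> tppX; have [sXG sYG sZG _] := subgroup_TPPP _ _ _ _ tppX.
  have nsXCG: X :&: C <| G by rewrite sub_center_normal // subIset ?sCZ ?orbT.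
  have [tiXC | ntXC] := eqVneq (X :&: C) 1; last first.
    right; apply: (TPP_bound_quotient nsXCG _ tppX); first exact: subsetIl.
    apply: (IHn _ _ (C / (X :&: C))%G).
    - by apply: leq_trans leGn; rewrite ltn_quotient ?normal_sub.
    - exact: quotient_pgroup.
    - by rewrite subsetI quotientS //= quotient_cents // centsC.
    by rewrite index_quotient_eq ?normal_norm // subIset // subsetIr orbT.
  have cXC: X \subset 'C(C) := subset_trans sXG cGC.
  have defXC: X <*> C = X * C by rewrite norm_joinEl // cents_norm.
  have sXCG: X <*> C \subset G by rewrite join_subG sXG.
  have cardXC: #|X <*> C| = (#|X| * #|C|)%N by rewrite defXC TI_cardMg.
  have iXC: (#|G : X <*> C| * #|X| = p ^ 3)%N.
    apply/eqP; rewrite -(eqn_pmul2r (cardG_gt0 C)) -mulnA -cardXC mulnC.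
    by rewrite Lagrange // -iCG mulnC Lagrange.
  have /(dvdn_pfactor _ _ p_pr)[k] : (#|X| %| p ^ 3)%N.
    by rewrite -iXC dvdn_mull.
  case: k => [|[|[|[|//]]]] _ oX.
  - by left; rewrite oX prime_gt0.
  - by left; rewrite oX.
  - right; have iXCp: #|G : X <*> C| = p.
      by apply/eqP; rewrite -(eqn_pmul2r (cardG_gt0 X)) iXC oX -expnS.
    apply: TPP_bound_abelian (p_pr) (pG) _ _ (iXCp) tppX.
      by rewrite (p_maximal_normal pG) ?p_index_maximal ?iXCp.
    rewrite /= defXC abelianM (card_p2group_abelian p_pr oX) centsC cXC andbT.
    by rewrite /abelian (subset_trans sCG).
  right; have defG: X * C = G.
    apply/eqP; rewrite -defXC eqEcard sXCG cardXC -(Lagrange sCG) iCG oX.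
    by rewrite mulnC leqnn.
  rewrite -mulnA mulnC; apply: TPP_bound_norm (subgroup_TPP_rot tppX) _.
  rewrite (subset_trans sZG) // -defG mulG_subG normG cents_norm //.
  by rewrite centsC.
have [[leS leT leU] | //] :=
  TPP_bound_or_all (small := fun X => (#|X| <= p)%N) small_or tppG.
rewrite (@leq_trans (p ^ 3)) //; last first.
  by rewrite -iCG dvdn_leq // dvdn_indexg.
by rewrite !expnS expn0 muln1 mulnA !leq_mul.
Qed.

End TripleProduct.

(** * Centres of irreducible characters and of their products *)

Section Characters.

Variables (gT : finGroupType) (G : {group gT}).
Implicit Types (i j k : Iirr G) (A : {group gT}).
Local Notation ker i := (cfker 'chi[G]_i).
Local Notation Z i := ('Z('chi[G]_i)%CF).

(** The centre of chi is the preimage of the centre of G / ker chi. *)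
Lemma sub_cfcenter_irr i A :
  A \subset G -> (A \subset Z i) = ([~: A, G]%g \subset ker i).
Proof.
move=> sAG; have nKG := normal_norm (cfker_normal 'chi_i).
rewrite -(quotientSGK (subset_trans sAG nKG)); last first.
  exact: normal_sub (cfker_center_normal _).
rewrite cfcenter_eq_center subsetI quotientS //= quotient_cents2 //.
exact: subset_trans nKG.
Qed.

(** By reciprocity chi_j is a constituent of conj(chi_i) chi_k, whose kernel
contains the intersection of those of its factors. *)
Lemma cfker_mul_constt i j k :
  k \in irr_constt ('chi_i * 'chi_j) -> ker i :&: ker k \subset ker j.
Proof.
rewrite irr_consttE => ijk.
have Cj: j \in irr_constt (('chi_i)^*%CF * 'chi_k).
  rewrite irr_consttE; apply: contraNneq ijk => ikj.
  rewrite cfdotC; apply/eqP/(canLR (@conjCK _)); rewrite conjC0.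
  rewrite -[RHS]ikj !cfdotE.
  congr (_ * _); apply: eq_bigr => x _; rewrite !cfunE rmorphM /=.
  by rewrite mulrCA mulrA.
apply: subset_trans (cfker_constt _ Cj); last first.
  by rewrite rpredM ?cfConjC_char ?irr_char.
by rewrite -{1}[ker i]cfker_conjC cfker_mul.
Qed.

Lemma irr_constt_mul_exists i j : exists k, k \in irr_constt ('chi_i * 'chi_j).
Proof.
apply: neq0_has_constt.
apply: contraTneq (mulf_neq0 (irr1_neq0 i) (irr1_neq0 j)).
by move/cfunP/(_ 1%g); rewrite !cfunE => ->; rewrite eqxx.
Qed.

(** The commutators of Z k with Z i lie in the kernels of both chi_k and chi_i,
hence in that of chi_j; those with Z j lie there anyway. So Z k commutes with
Z i * Z j = G modulo ker j, that is, Z k lies in Z j. *)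
Lemma cfcenter_mul_constt i j k :
    k \in irr_constt ('chi_i * 'chi_j) -> (Z i * Z j)%g = G ->
  Z k \subset Z i :&: Z j.
Proof.
move=> ijk defG.
have sub_right i' j' : k \in irr_constt ('chi_i' * 'chi_j') ->
    (Z i' * Z j')%g = G -> Z k \subset Z j'.
  move=> ijk' defG'; have nKG := normal_norm (cfker_normal 'chi_j').
  have [sZk sZi sZj] : [/\ Z k \subset G, Z i' \subset G & Z j' \subset G].
    by rewrite !cfcenter_sub.
  have nK l : (Z l \subset 'N(ker j'))%g.
    by apply: subset_trans nKG; apply: cfcenter_sub.
  rewrite sub_cfcenter_irr // -quotient_cents2 //; last exact: (nK k).
  have ->: (G / ker j' = (Z i' / ker j') * (Z j' / ker j'))%g.
    by rewrite -quotientMl // defG'.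
  rewrite centM subsetI !quotient_cents2 ?nK //.
  apply/andP; split.
    apply: subset_trans (cfker_mul_constt ijk'); rewrite subsetI.
    rewrite [[~: _, _]%g]commGC (subset_trans (commgS _ sZk)) //;
      last by rewrite -sub_cfcenter_irr.
    by rewrite commGC (subset_trans (commgS _ sZi)) -?sub_cfcenter_irr.
  by rewrite commGC (subset_trans (commgS _ sZk)) // -sub_cfcenter_irr.
rewrite subsetI (sub_right i j) // andbT.
rewrite (sub_right j i) //; first by rewrite mulrC.
rewrite -[RHS]defG normC // (subset_trans (cfcenter_sub _)) //.
by rewrite normal_norm ?cfcenter_normal.
Qed.

End Characters.

(** * Families of subgroups of codimension two *)

Section Codimension2.

Local Open Scope group_scope.

(** If K i and K j are incomparable, their join has index p and their meet index
p ^ 3. Suppose that no subgroup of index p contains all the K i. Then some two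
of them, K i0 and K j0, are distinct, and some K i3 is not contained in
H = K i0 <*> K j0. Let M be the meet of K i0 and K j0. For any K i outside H
the three meets of K i with K i0, K j0 and H all have index p ^ 3, so they
coincide with M. A K i inside H meets K i3 inside H :&: K i3 = M, again with
index p ^ 3, so that it contains M as well. *)
Lemma codim2_join_alternative (p : nat) (gT : finGroupType) (G : {group gT})
    (I : finType) (P : pred I) (K : I -> {group gT}) (i0 : I) :
    prime p -> p.-group G -> P i0 ->
    (forall i, P i -> K i <| G /\ #|G : K i| = (p ^ 2)%N) ->
    (forall i j, P i -> P j -> K i * K j <> G) ->
  (exists H : {group gT},
     [/\ H <| G, #|G : H| = p & forall i, P i -> K i \subset H]) \/
  (exists M : {group gT},
     [/\ M \subset G, #|G : M| = (p ^ 3)%N & forall i, P i -> M \subset K i]).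
Proof.
move=> p_pr pG Pi0 Kprop KKneqG.
have p_gt0 := prime_gt0 p_pr; have p_gt1 := prime_gt1 p_pr.
have nsK i : P i -> K i <| G by case/Kprop.
have sKG i : P i -> K i \subset G by move/nsK/normal_sub.
have oK i : P i -> #|G| = (p ^ 2 * #|K i|)%N.
  by move=> Pi; rewrite -(Lagrange (sKG i Pi)) (Kprop i Pi).2 mulnC.
have K_max i : P i -> exists2 H : {group gT}, maximal H G & K i \subset H.
  move=> Pi; have [/esym eqKG | //] := maximal_exists (sKG i Pi).
  by have := ltn_expl 2 p_gt1; rewrite -(Kprop i Pi).2 -eqKG indexgg.
have [/existsP[H /and3P[nsHG /eqP iHG /forall_inP sKH]] | noH] :=
  boolP [exists H : {group gT},
    [&& H <| G, #|G : H| == p & [forall (i | P i), K i \subset H]]].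
  by left; exists H.
right.
have escape (H : {group gT}) : H <| G -> #|G : H| = p ->
    exists2 i, P i & ~~ (K i \subset H).
  move=> nsHG iHG; move: noH; rewrite negb_exists => /forallP/(_ H).
  by rewrite nsHG iHG eqxx /= negb_forall_in => /exists_inP.
have escape_max (H : {group gT}) : maximal H G ->
    exists2 i, P i & ~~ (K i \subset H).
  move=> maxH; apply: escape; first exact: p_maximal_normal pG maxH.
  exact: p_maximal_index pG maxH.
have join_index i j : P i -> P j -> ~~ (K j \subset K i) ->
    #|G : K i <*> K j| = p /\ #|G| = (p ^ 3 * #|K i :&: K j|)%N.
  move=> Pi Pj nsKji; have nKij: K j \subset 'N(K i).
    by rewrite (subset_trans (sKG j Pj)) ?normal_norm ?nsK.
  have defY: K i <*> K j = K i * K j by rewrite norm_joinEr.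
  have sYG: K i <*> K j \subset G by rewrite join_subG !sKG.
  have iY: #|G : K i <*> K j| = p.
    have sKY: K i \subset K i <*> K j := joing_subl _ _.
    have iYK: (#|G : K i <*> K j| * #|K i <*> K j : K i| = p ^ 2)%N.
      by rewrite Lagrange_index // (Kprop i Pi).2.
    have /(dvdn_pfactor _ _ p_pr)[k] : (#|G : K i <*> K j| %| p ^ 2)%N.
      by rewrite -iYK dvdn_mulr.
    case: k => [|[|[|//]]] _ iY //.
      case: (KKneqG i j Pi Pj); apply/eqP; rewrite -defY eqEsubset sYG /=.
      by rewrite -indexg_eq1 iY.
    case/negP: nsKji; apply: subset_trans (joing_subr (K i) (K j)) _.
    rewrite -indexg_eq1 -(@eqn_pmul2l (p ^ 2)) ?expn_gt0 ?p_gt0 //.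
    by rewrite -{1}iY iYK muln1.
  split=> //; apply/eqP; rewrite -(eqn_pmul2r (cardG_gt0 G)).
  rewrite {1}(oK i Pi) {1}(oK j Pj) mulnACA mul_cardG -defY.
  rewrite -[#|G| in X in _ == X](Lagrange sYG) iY; apply/eqP; ring.
have [H1 maxH1 sK0H1] := K_max i0 Pi0.
have [j0 Pj0 nsKj0] := escape_max H1 maxH1.
have nsK0 : ~~ (K j0 \subset K i0).
  by apply: contra nsKj0 => /subset_trans->.
have [iH oM] := join_index _ _ Pi0 Pj0 nsK0.
set H := (K i0 <*> K j0)%G in iH; set M := (K i0 :&: K j0)%G in oM.
have sHG : H \subset G by rewrite join_subG !sKG.
have maxH: maximal H G by rewrite p_index_maximal ?iH.
have nsHG := p_maximal_normal pG maxH.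
have oIM i j : P i -> P j -> ~~ (K j \subset K i) -> #|K i :&: K j| = #|M|.
  move=> Pi Pj nsKji; have [_ oG] := join_index i j Pi Pj nsKji.
  apply/eqP; rewrite -(@eqn_pmul2l (p ^ 3)) ?expn_gt0 ?p_gt0 //.
  by rewrite -oG -oM.
have outside i : P i -> ~~ (K i \subset H) -> K i :&: H = M.
  move=> Pi nsKiH.
  have oKH: #|K i :&: H| = #|M|.
    have defG: H * K i = G by apply: mulg_normal_maximal; rewrite ?sKG.
    have cardM: (#|H| * #|K i| = #|G| * #|K i :&: H|)%N.
      by rewrite mul_cardG defG setIC.
    have cardG: #|G| = (p * #|H|)%N by rewrite -(Lagrange sHG) iH mulnC.
    apply/eqP; rewrite -(@eqn_pmul2l (p ^ 3)) ?expn_gt0 ?p_gt0 // -oM.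
    rewrite -(eqn_pmul2l (cardG_gt0 G)) mulnCA -cardM {2}cardG (oK i Pi).
    by apply/eqP; ring.
  have meet j : P j -> K j \subset H -> K i :&: H = K j :&: K i.
    move=> Pj sKjH; apply/esym/eqP; rewrite eqEcard setIC setIS //= oKH.
    rewrite setIC oIM //; apply: contra nsKiH => /subset_trans-> //.
  apply/eqP; rewrite eqEcard oKH leqnn andbT subsetI.
  by rewrite {1}(meet i0) ?(meet j0) ?subsetIl ?joing_subl ?joing_subr.
exists M; split; first by rewrite subIset ?sKG.
  apply/eqP; rewrite -(eqn_pmul2r (cardG_gt0 M)) -oM mulnC Lagrange //.
  by rewrite subIset ?sKG.
have [i3 Pi3 nsK3] := escape _ nsHG iH.
move=> i Pi; have [sKH | nsKH] := boolP (K i \subset H); last first.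
  by rewrite -(outside i) // subsetIl.
have <-: K i :&: K i3 = M; last exact: subsetIl.
apply/eqP; rewrite eqEcard -{1}(outside _ Pi3 nsK3) [K i3 :&: _]setIC setSI //=.
by rewrite (oIM i i3) //; apply: contra nsK3 => /subset_trans->.
Qed.

End Codimension2.

(** * Structure of the groups of class 2 with degrees 1 and p *)

Section DegreesOneP.

Variables (p : nat) (gT : finGroupType) (G : {group gT}).
Hypotheses (p_pr : prime p) (pG : (p.-group G)%g).
Hypotheses (class2G : (G^`(1) \subset 'Z(G))%g).
Hypothesis cdG : {subset cd G <= [:: 1; p%:R]}.

(** In class 2 the quotient of G by the centre of chi_i is abelian, and then the
index of that centre is the square of the degree. *)
Lemma index_cfcenter_irr (i : Iirr G) :
  #|G : 'Z('chi_i)%CF|%g = (if 'chi_i \is a linear_char then 1 else p ^ 2)%N.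
Proof.
have sZZ: ('Z(G) \subset 'Z('chi_i)%CF)%g.
  by rewrite -cap_cfcenter_irr bigcap_inf.
have abGZ: abelian (G / 'Z('chi_i)%CF)%g.
  by rewrite sub_der1_abelian // (subset_trans class2G).
have /eqP := irr1_abelian_bound abGZ.
have : 'chi_i 1%g \in [:: 1; p%:R] by apply/cdG/image_f.
have -> : ('chi_i \is a linear_char) = ('chi_i 1%g == 1).
  by rewrite qualifE /= irr_char.
rewrite !inE; have [-> _ | _ /= /eqP->] := eqVneq.
  by rewrite expr1n eq_sym pnatr_eq1 => /eqP->.
by rewrite -natrX eqr_nat => /eqP->.
Qed.

(** Otherwise the two centres would meet in index p ^ 4, and would contain in
common the centre of a constituent of chi_i chi_j, of index at most p ^ 2. *)
Lemma mul_cfcenter_neq (i j : Iirr G) :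
    'chi_i \isn't a linear_char -> 'chi_j \isn't a linear_char ->
  ('Z('chi_i)%CF * 'Z('chi_j)%CF)%g <> G.
Proof.
move=> nli nlj defG; have [k ijk] := irr_constt_mul_exists i j.
have sZk := cfcenter_mul_constt ijk defG.
have p_gt1 := prime_gt1 p_pr.
have iZ l : 'chi_l \isn't a linear_char ->
    #|G| = (p ^ 2 * #|'Z('chi[G]_l)%CF|)%N.
  move=> nll; rewrite -(Lagrange (cfcenter_sub 'chi_l)) index_cfcenter_irr.
  by rewrite (negPf nll) mulnC.
have leGk: (#|G| <= p ^ 2 * #|'Z('chi[G]_i)%CF :&: 'Z('chi_j)%CF|)%N.
  rewrite -(Lagrange (cfcenter_sub 'chi_k)) index_cfcenter_irr mulnC.
  rewrite leq_mul ?subset_leq_card //.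
  by case: ifP; rewrite // expn_gt0 prime_gt0.
have := mul_cardG 'Z('chi[G]_i)%CF 'Z('chi_j)%CF; rewrite /= defG => cardZ.
have: (#|'Z('chi[G]_i)%CF| * #|'Z('chi_j)%CF|
       < #|G| * #|'Z('chi[G]_i)%CF :&: 'Z('chi_j)%CF|)%N.
  (* Multiplied by p ^ 4, the left-hand side becomes |G| ^ 2. *)
  rewrite -(@ltn_pmul2l (p ^ 2 * p ^ 2)) ?muln_gt0 ?expn_gt0 ?prime_gt0 //.
  rewrite mulnACA -!iZ // mulnCA ltn_pmul2l ?cardG_gt0 //.
  rewrite -mulnA (leq_ltn_trans leGk) // ltn_Pmull ?(ltn_exp2l 0) //.
  by rewrite muln_gt0 cardG_gt0 expn_gt0 prime_gt0.
by rewrite cardZ ltnn.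
Qed.

(** Modulo the kernel of a nonlinear chi_i, its centre becomes a central
subgroup of index p in H, so H' lies in that kernel. Linear characters are
trivial on G', and the kernels of all the irreducible characters meet
trivially. *)
Lemma abelian_sub_cfcenter (H : {group gT}) :
    (H <| G)%g -> #|G : H|%g = p ->
    (forall i : Iirr G, 'chi_i \isn't a linear_char ->
       'Z('chi_i)%CF \subset H) ->
  abelian H.
Proof.
move=> nsHG iHG sZH; have sHG := normal_sub nsHG.
rewrite (sameP (@derG1P _ H) eqP) -subG1 -(TI_cfker_irr G).
apply/bigcapsP=> i _; have [lin_i | nlin_i] := boolP ('chi_i \is a linear_char).
  by rewrite (subset_trans (dergS 1 sHG)) ?lin_char_der1.
have sZi := sZH i nlin_i; have nKG := normal_norm (cfker_normal 'chi_i).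
have nsKZ := cfker_center_normal 'chi_i; have nKH := subset_trans sHG nKG.
rewrite -quotient_cents2 //.
have iHZ: #|H : 'Z('chi_i)%CF|%g = p.
  apply/eqP; rewrite -(@eqn_pmul2l p) ?prime_gt0 // -{1}iHG.
  by rewrite Lagrange_index // index_cfcenter_irr (negPf nlin_i).
have nZH: (H \subset 'N('Z('chi_i)%CF))%g.
  by rewrite (subset_trans sHG) ?normal_norm ?cfcenter_normal.
apply: (@cyclic_factor_abelian _
          ('Z('chi_i)%CF / cfker 'chi_i)%G (H / cfker 'chi_i)%G).
  rewrite subsetI quotientS //= cfcenter_eq_center.
  by rewrite (subset_trans (subsetIr _ _)) ?centS ?quotientS.
rewrite prime_cyclic // card_quotient ?quotient_norms //.
by rewrite index_quotient_eq ?iHZ // subIset // (normal_sub nsKZ) orbT.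
Qed.

(** The alternative for the centres of the nonlinear irreducible characters is
read off in terms of G: their upper bound is abelian, and a common lower bound
is central because the centres of all the irreducible characters meet in
Z(G). *)
Theorem degrees_1p_structure : ~~ abelian G ->
  (exists A : {group gT}, [/\ A <| G, abelian A & #|G : A| = p]%g) \/
  (exists C : {group gT}, (C \subset 'Z(G))%g /\ #|G : C|%g = (p ^ 3)%N).
Proof.
move=> nabG.
have [i0 nlin0] : exists i : Iirr G, 'chi_i \isn't a linear_char.
  apply/existsP; apply: contraR nabG; rewrite negb_exists => /forallP lin.
  by apply/char_abelianP=> i; have:= lin i; rewrite negbK.
have nonlin i : 'chi[G]_i \isn't a linear_char ->
    ('Z('chi_i)%CF <| G)%g /\ #|G : 'Z('chi_i)%CF|%g = (p ^ 2)%N.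
  by move=> nlin; rewrite cfcenter_normal index_cfcenter_irr (negPf nlin).
have [[H [nsHG iHG sZH]] | [M [sMG iGM sMZ]]] :=
  codim2_join_alternative p_pr pG (K := fun i : Iirr G => cfcenter_group 'chi_i)
    (P := fun i => 'chi_i \isn't a linear_char) nlin0 nonlin mul_cfcenter_neq.
  by left; exists H; split=> //; apply: abelian_sub_cfcenter.
right; exists M; split=> //; rewrite -cap_cfcenter_irr; apply/bigcapsP=> i _.
have [lin_i | /sMZ//] := boolP ('chi_i \is a linear_char).
suff ->: 'Z('chi_i)%CF = G by [].
apply/eqP; rewrite eqEsubset cfcenter_sub -indexg_eq1.
by rewrite index_cfcenter_irr lin_i.
Qed.

End DegreesOneP.

(** * The subgroup TPP ratio *)

Theorem theorem6p1 (p : nat) (gT : finGroupType) (G : {group gT}) :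
  prime p -> (p.-group G)%g -> nil_class G = 2%N -> cd G =i [:: 1; p%:R] ->
  rho0 G = 1.
Proof.
move=> p_pr pG cl2 cdG.
have /and4P[nabG _ class2 _] :
    [&& ~~ abelian G, (1%G \proper G^`(1))%g, (G^`(1) \subset 'Z(G))%g
      & ('Z(G) \proper G)%g].
  by rewrite -nil_class2E ?cl2 // (pgroup_nil pG).
have G_gt0 : 0 < #|G|%:R :> rat by rewrite ltr0n cardG_gt0.
apply/le_anti/andP; split.
  have [S [T [U [tpp ->]]]] := rho0_attained G.
  rewrite ler_pdivrMr // mul1r ler_nat.
  have [x | [A [nsAG abA iAG]] | [C [sCZ iCG]]] :=
    degrees_1p_structure p_pr pG class2 _ nabG.
  - by rewrite cdG.
  - exact: TPP_bound_abelian nsAG abA iAG tpp.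
  exact: TPP_bound_central sCZ iCG tpp.
have tpp : subgroup_TPP G G 1%G 1%G.
  apply/subgroup_TPPP; split; rewrite ?sub1G // => s t u _ /set1P-> /set1P->.
  by rewrite !mulg1.
apply: le_trans (rho0_ge tpp).
by rewrite !cards1 !muln1 divff // gt_eqF.
Qed.
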